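(* Let $n\ge3$ and let $B=B(x,s,p,\nu,H)$ be a conformally invariant boundary operator. Then for all $x\in\mathbb{R}^n$, $s>0$, $p\in\mathbb{R}^n$, unit vectors $\nu\in\mathbb{R}^n$ and symmetric $n\times n$ matrices $H$, $$B(x,s,p,\nu,H)=B\Big(0,1,0,e,s^{-\frac{2}{n-2}}\big(H+\tfrac{2}{n-2}\tfrac{p\cdot\nu}{s}I\big)\Big),$$ where $e$ is any arbitrary unit vector. In particular, prescribing a conformally invariant boundary condition on an umbilic boundary is equivalent to prescribing its mean curvature: for $H=hI$, the value $B(x,s,p,\nu,hI)$ is a function only of $s^{-\frac{2}{n-2}}\big(h+\frac{2}{n-2}\frac{p\cdot\nu}{s}\big)$.
   Context: A boundary operator is a real-valued function $B(x,u,\nabla u,\nu,H)$ of a point $x\in\mathbb{R}^n$, a positive number $u$, a vector $\nabla u\in\mathbb{R}^n$, a unit vector $\nu\in\mathbb{R}^n$ and a symmetric $n\times n$ matrix $H$ (where $\nu$ and $H$ play the roles of the outer unit normal and the Weingarten map of the boundary). $B$ is conformally invariant if for any Möbius transformation $\psi$ of $\mathbb{R}^n$, any positive $u\in C^1(\mathbb{R}^n)$, any continuous unit-vector-valued $\nu$ on $\mathbb{R}^n$, and any continuous symmetric-matrix-valued $H$ on $\mathbb{R}^n$, there holds (at points where $\psi$ is finite) $$B(\cdot,u_\psi,\nabla u_\psi,\nu,H)=B(\psi,u\circ\psi,(\nabla u)\circ\psi,\nu_\psi,H_\psi),$$ where, with $|Jac_\psi|$ the absolute value of the Jacobian determinant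 of $\psi$, $$u_\psi(x)=|Jac_\psi(x)|^{\frac{n-2}{2n}}\,u(\psi(x)),\qquad \nu_\psi(x)=\frac{d\psi(x)(\nu(x))}{|d\psi(x)(\nu(x))|},$$ $$H_\psi(x)=|Jac_\psi(x)|^{-\frac1n}\Big(H(x)+\frac1n\frac{\nabla|Jac_\psi(x)|\cdot\nu(x)}{|Jac_\psi(x)|}I\Big).$$ *)

(* Defs.v *)
From HB Require Import structures.
From mathcomp Require Import all_boot all_order all_algebra.
From mathcomp Require Import all_classical all_reals all_analysis.

Set Implicit Arguments.
Unset Strict Implicit.
Unset Printing Implicit Defensive.

Import Order.TTheory GRing.Theory Num.Theory.
Import numFieldNormedType.Exports.
Local Open Scope classical_set_scope.
Local Open Scope ring_scope.

(* The MathComp-Analysis norm `|v| on row vectors is the sup norm, so the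
   Euclidean inner product and norm are introduced here.  The topology,
   derivatives and continuity do not depend on this choice. *)
Definition dot (R : realType) (n : nat) (v w : 'rV[R]_n) : R :=
  \sum_(i < n) v 0 i * w 0 i.

Definition enorm (R : realType) (n : nat) (v : 'rV[R]_n) : R :=
  Num.sqrt (dot v v).

Definition unit_vector (R : realType) (n : nat) (v : 'rV[R]_n) : Prop :=
  enorm v = 1.

Definition gradient (R : realType) (n : nat) (f : 'rV[R]_n -> R)
    (x : 'rV[R]_n) : 'rV[R]_n :=
  \row_(i < n) 'D_(delta_mx 0 i) f x.

Definition C1 (R : realType) (n : nat) (f : 'rV[R]_n -> R) : Prop :=
  (forall x, differentiable f x) /\ continuous (gradient f).

(* In the compactification of R^n, [None] is the point at infinity. *)
Definition sphere_inversion (R : realType) (n : nat) (c : 'rV[R]_n) (r : R)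
    (x : one_point_compactification 'rV[R]_n) :
    one_point_compactification 'rV[R]_n :=
  match x with
  | Some y =>
      if y == c then None
      else Some (c + (r ^+ 2 / enorm (y - c) ^+ 2) *: (y - c))
  | None => Some c
  end.

(* Reflection in the hyperplane of equation [dot y a = t]. *)
Definition hyperplane_reflection (R : realType) (n : nat) (a : 'rV[R]_n)
    (t : R) (x : one_point_compactification 'rV[R]_n) :
    one_point_compactification 'rV[R]_n :=
  match x with
  | Some y => Some (y - (2 * (dot y a - t) / enorm a ^+ 2) *: a)
  | None => None
  end.

(* Finite compositions of reflections in spheres and hyperplanes.  The
   identity is included, every reflection being an involution. *)
Inductive mobius (R : realType) (n : nat) :
    (one_point_compactification 'rV[R]_n ->
     one_point_compactification 'rV[R]_n) -> Prop :=
| mobius_sphere (c : 'rV[R]_n) (r : R) :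
    0 < r -> mobius (sphere_inversion c r)
| mobius_hyperplane (a : 'rV[R]_n) (t : R) :
    a != 0 -> mobius (hyperplane_reflection a t)
| mobius_comp phi psi : mobius phi -> mobius psi -> mobius (phi \o psi).

(* The map from R^n to R^n underlying [psi]; the value 0 at the (at most one)
   point sent to infinity is a convention. *)
Definition finite_part (R : realType) (n : nat)
    (psi : one_point_compactification 'rV[R]_n ->
           one_point_compactification 'rV[R]_n) (x : 'rV[R]_n) : 'rV[R]_n :=
  odflt 0 (psi (Some x)).

Definition absJac (R : realType) (n : nat) (f : 'rV[R]_n -> 'rV[R]_n)
    (x : 'rV[R]_n) : R :=
  `| \det (jacobian f x) |.

Definition u_transform (R : realType) (n : nat) (f : 'rV[R]_n -> 'rV[R]_n)
    (u : 'rV[R]_n -> R) (x : 'rV[R]_n) : R :=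
  absJac f x `^ ((n%:R - 2) / (2 * n%:R)) * u (f x).

Definition nu_transform (R : realType) (n : nat) (f : 'rV[R]_n -> 'rV[R]_n)
    (nu : 'rV[R]_n -> 'rV[R]_n) (x : 'rV[R]_n) : 'rV[R]_n :=
  (enorm ('d f x (nu x)))^-1 *: 'd f x (nu x).

Definition H_transform (R : realType) (n : nat) (f : 'rV[R]_n -> 'rV[R]_n)
    (nu : 'rV[R]_n -> 'rV[R]_n) (H : 'rV[R]_n -> 'M[R]_n) (x : 'rV[R]_n) :
    'M[R]_n :=
  absJac f x `^ (- (1 / n%:R)) *:
    (H x + (1 / n%:R * (dot (gradient (absJac f) x) (nu x) / absJac f x))%:M).

(* Arguments: x, u > 0, the gradient of u, the unit vector nu, the symmetric
   matrix H.  Values at a nonpositive u, a non-unit nu or a non-symmetric H are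
   junk and are never constrained nor asserted anything about. *)
Definition boundary_operator (R : realType) (n : nat) : Type :=
  'rV[R]_n -> R -> 'rV[R]_n -> 'rV[R]_n -> 'M[R]_n -> R.

Definition conformally_invariant (R : realType) (n : nat)
    (B : boundary_operator R n) : Prop :=
  forall (psi : one_point_compactification 'rV[R]_n ->
                one_point_compactification 'rV[R]_n)
         (u : 'rV[R]_n -> R) (nu : 'rV[R]_n -> 'rV[R]_n)
         (H : 'rV[R]_n -> 'M[R]_n),
    mobius psi ->
    (forall x, 0 < u x) -> C1 u ->
    (forall x, unit_vector (nu x)) -> continuous nu ->
    (forall x, (H x)^T = H x) -> continuous H ->
    forall x : 'rV[R]_n, psi (Some x) <> None ->
      let f := finite_part psi in
      B x (u_transform f u x) (gradient (u_transform f u) x) (nu x) (H x) =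
      B (f x) (u (f x)) (gradient u (f x))
        (nu_transform f nu x) (H_transform f nu H x).

(* Main.v *)
Require Import Defs.
From HB Require Import structures.
From mathcomp Require Import all_boot all_order all_algebra.
From mathcomp Require Import all_classical all_reals all_analysis.
From mathcomp Require Import ring.

Set Implicit Arguments.
Unset Strict Implicit.
Unset Printing Implicit Defensive.

Import Order.TTheory GRing.Theory Num.Theory.
Import numFieldNormedType.Exports.
Local Open Scope ring_scope.

(* Invariance is applied to u = 1 and constant nu and H.  Since the values of
   u_psi, grad u_psi and H_psi at x then depend only on |Jac psi| and its
   gradient at x, it suffices to find psi with |Jac psi|^((n-2)/2n) = s and
   grad |Jac psi|^((n-2)/2n) = p at x: for p <> 0 this is an inversion centred
   on the line x + R p, for p = 0 a dilation, which is the composition of two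
   concentric inversions.  This reduces to s = 1 and p = 0, where hyperplane
   reflections, for which |Jac psi| = 1, move x to 0 and nu to e. *)

(** * Rules of differential calculus *)

(** The first-order expansion at [x] only involves values near [x]. This serves for inversions,
    whose rational formula holds only away from the centre. *)
Lemma near_eq_is_diff (R : realType) (V W : normedModType R) (f g df : V -> W)
    (x : V) :
  (\forall y \near x, f y = g y) -> is_diff x f df -> is_diff x g df.
Proof.
move=> fg [fx <-].
have [cf /eqaddoP of_] := (diff_locallyP _ _).1 fx.
have gE : g \o shift x = cst (g x) + 'd f x +o_ 0 id.
  apply/eqaddoP => e e0; move: (of_ e e0); apply: filter_app.
  have : \forall h \near 0, f (h + x) = g (h + x).
    move: fg; rewrite (near_shift 0 x); apply: filterS => h.
    by rewrite /= subr0.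
  apply: filterS => h fgh; rewrite /= !fctE /= fgh.
  by rewrite (nbhs_singleton fg).
have dg : 'd g x = 'd f x :> (V -> W) by exact: diff_unique.
by split; last exact: dg; apply/diff_locallyP; rewrite dg.
Qed.

Lemma is_diff_sum (R : realType) (V W : normedModType R) (n : nat)
    (f df : 'I_n -> V -> W) (x : V) :
  (forall i, is_diff x (f i) (df i)) ->
  is_diff x (fun y => \sum_(i < n) f i y) (fun v => \sum_(i < n) df i v).
Proof.
move=> fdf; rewrite -!fct_sumE.
by elim/big_ind2 : _ => [|F dF G dG ? ?|//]; [exact: is_diff_cst|exact: is_diffD].
Qed.

Lemma is_diff_coord (R : realType) (m n : nat) (M : 'M[R]_(m, n))
    (i : 'I_m) (j : 'I_n) :
  is_diff M (fun N : 'M[R]_(m, n) => N i j : R) (fun N : 'M[R]_(m, n) => N i j).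
Proof.
split; first exact: differentiable_coord.
apply/funext => N; rewrite -deriveE; last exact: differentiable_coord.
(* A coordinate is linear, so its difference quotient is constant for nonzero [h]. *)
rewrite /derive; apply: lim_near_cst => //.
near=> h; rewrite /= !mxE addrK /GRing.scale /= mulKf//.
near: h; exact: nbhs_dnbhs_neq.
Unshelve. all: by end_near. Qed.

Lemma is_diff_derive_comp (R : realType) (V : normedModType R) (f df : V -> R)
    (g : R -> R) (dg : R) (x : V) :
  is_diff x f df -> is_derive (f x) 1 g dg ->
  is_diff x (g \o f) (fun v => dg * df v).
Proof.
move=> fdf [gd gE].
have gdiff : is_diff (f x) g ( *:%R ^~ dg).
  split; first exact/derivable1_diffP.
  by rewrite deriv1E// derive1E gE.
apply: is_diff_eq; apply/funext => v.
by rewrite /= /GRing.scale /= mulrC.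
Qed.

(** Expanding [g] in the standard basis reduces this to the product rule for real-valued
    functions. *)
Lemma is_diff_scale (R : realType) (V : normedModType R) (n : nat)
    (k dk : V -> R) (g dg : V -> 'rV[R]_n) (x : V) :
  is_diff x k dk -> is_diff x g dg ->
  is_diff x (fun y => k y *: g y) (fun v => k x *: dg v + dk v *: g x).
Proof.
move=> kd gd.
have coord (w : 'rV[R]_n) : w = \sum_i w 0 i *: delta_mx 0 i.
  exact: row_sum_delta.
have -> : (fun y => k y *: g y) =
    (fun y => \sum_i (k y * g y 0 i) *: (delta_mx 0 i : 'rV[R]_n)).
  apply/funext => y; rewrite [in LHS](coord (g y)) scaler_sumr.
  by apply: eq_bigr => i _; rewrite scalerA.
have -> : (fun v => k x *: dg v + dk v *: g x) =
    (fun v => \sum_i (k x * dg v 0 i + g x 0 i * dk v)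
                *: (delta_mx 0 i : 'rV[R]_n)).
  apply/funext => v; rewrite [LHS]coord; apply: eq_bigr => i _.
  by rewrite !mxE [dk v * _]mulrC.
apply: is_diff_sum => i.
have ci : is_diff x (fun y => g y 0 i) (fun v => dg v 0 i).
  exact: (@is_diff_comp _ _ _ _ g dg (fun N : 'rV[R]_n => N 0 i)
    (fun N : 'rV[R]_n => N 0 i) x gd (is_diff_coord _ _ _)).
have kg : is_diff x (fun y => k y * g y 0 i)
    (fun v => k x * dg v 0 i + g x 0 i * dk v) by exact: is_diffM.
exact: (@is_diff_comp _ _ _ _ _ _ _ _ x kg (is_diff_scalel _ _)).
Qed.

(** * The Euclidean inner product *)

Lemma dotC (R : realType) (n : nat) (v w : 'rV[R]_n) : dot v w = dot w v.
Proof. by apply: eq_bigr => i _; rewrite mulrC. Qed.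

Lemma dotDl (R : realType) (n : nat) (u v w : 'rV[R]_n) :
  dot (u + v) w = dot u w + dot v w.
Proof. by rewrite -big_split; apply: eq_bigr => i _; rewrite !mxE mulrDl. Qed.

Lemma dotZl (R : realType) (n : nat) (a : R) (v w : 'rV[R]_n) :
  dot (a *: v) w = a * dot v w.
Proof. by rewrite mulr_sumr; apply: eq_bigr => i _; rewrite !mxE mulrA. Qed.

Lemma dotNl (R : realType) (n : nat) (v w : 'rV[R]_n) :
  dot (- v) w = - dot v w.
Proof. by rewrite -scaleN1r dotZl mulN1r. Qed.

Lemma dotBl (R : realType) (n : nat) (u v w : 'rV[R]_n) :
  dot (u - v) w = dot u w - dot v w.
Proof. by rewrite dotDl dotNl. Qed.

Lemma dotBr (R : realType) (n : nat) (u v w : 'rV[R]_n) :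
  dot u (v - w) = dot u v - dot u w.
Proof. by rewrite !(dotC u) dotBl. Qed.

Lemma dotZr (R : realType) (n : nat) (a : R) (v w : 'rV[R]_n) :
  dot v (a *: w) = a * dot v w.
Proof. by rewrite dotC dotZl dotC. Qed.

Lemma dot0l (R : realType) (n : nat) (v : 'rV[R]_n) : dot 0 v = 0.
Proof. by rewrite -(scale0r v) dotZl mul0r. Qed.

Lemma dot_delta (R : realType) (n : nat) (v : 'rV[R]_n) (i : 'I_n) :
  dot v (delta_mx 0 i) = v 0 i.
Proof.
rewrite /dot (bigD1 i)//= mxE !eqxx mulr1 big1 ?addr0// => j /negbTE ji.
by rewrite mxE ji andbF mulr0.
Qed.

Lemma dotvv_ge0 (R : realType) (n : nat) (v : 'rV[R]_n) : 0 <= dot v v.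
Proof. by apply: sumr_ge0 => i _; rewrite -expr2 sqr_ge0. Qed.

Lemma dotvv_gt0 (R : realType) (n : nat) (v : 'rV[R]_n) :
  (0 < dot v v) = (v != 0).
Proof.
rewrite lt_def dotvv_ge0 andbT; congr negb; apply/eqP/eqP => [|->]; last first.
  by rewrite dot0l.
move/psumr_eq0P => v0; apply/rowP => i; rewrite mxE; apply/eqP.
by rewrite -sqrf_eq0 expr2 v0// => j _; rewrite -expr2 sqr_ge0.
Qed.

Lemma sqr_enorm (R : realType) (n : nat) (v : 'rV[R]_n) :
  enorm v ^+ 2 = dot v v.
Proof. by rewrite sqr_sqrtr ?dotvv_ge0. Qed.

Lemma unit_vectorP (R : realType) (n : nat) (v : 'rV[R]_n) :
  unit_vector v <-> dot v v = 1.
Proof.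
by split=> [v1|v1]; [rewrite -sqr_enorm v1 expr1n|rewrite /unit_vector /enorm v1 sqrtr1].
Qed.

Lemma is_diff_dotvv (R : realType) (n : nat) (c x : 'rV[R]_n) :
  is_diff x (fun y => dot (y - c) (y - c)) (fun v => 2 * dot (x - c) v).
Proof.
(* The doubled terms have the shape that the product rule gives for each squared coordinate. *)
have -> : (fun v => 2 * dot (x - c) v) =
    (fun v => \sum_i ((x - c) 0 i * v 0 i + (x - c) 0 i * v 0 i)).
  apply/funext => v; rewrite mulr_sumr; apply: eq_bigr => i _.
  by rewrite mulr_natl mulr2n.
apply: is_diff_sum => i.
have di : is_diff x (fun y : 'rV[R]_n => (y - c) 0 i) (fun v => v 0 i).
  have -> : (fun y : 'rV[R]_n => (y - c) 0 i) = (fun y => y 0 i) - cst (c 0 i).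
    by apply/funext => y; rewrite !mxE.
  have ci := is_diff_coord x 0 i.
  apply: is_diff_eq (is_diffB ci (is_diff_cst (c 0 i) x)) _.
  by apply/funext => v; exact: subr0.
exact: is_diffM.
Qed.

(** * Reflection matrices and Jacobian matrices *)

(** Householder matrix of the orthogonal reflection in the hyperplane normal to [a], acting on row
    vectors from the right. It is the linear part of [hyperplane_reflection] and, up to a positive
    factor, the differential of an inversion. *)
Definition reflection_mx (R : realType) (n : nat) (a : 'rV[R]_n) : 'M[R]_n :=
  1%:M - (2 / dot a a) *: (a^T *m a).

Lemma mul_reflection_mx (R : realType) (n : nat) (a v : 'rV[R]_n) :
  v *m reflection_mx a = v - (2 * dot v a / dot a a) *: a.
Proof.
rewrite mulmxBr mulmx1 -scalemxAr mulmxA.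
have -> : v *m a^T = (dot v a)%:M.
  apply/rowP => i; rewrite ord1 !mxE eqxx mulr1n.
  by apply: eq_bigr => j _; rewrite mxE.
by rewrite mul_scalar_mx scalerA; congr (_ - _ *: _); rewrite mulrAC.
Qed.

Lemma reflection_mxK (R : realType) (n : nat) (a : 'rV[R]_n) :
  a != 0 -> reflection_mx a *m reflection_mx a = 1%:M.
Proof.
rewrite -dotvv_gt0 => /lt0r_neq0 a0.
apply/row_matrixP => i; rewrite rowE mulmxA !mul_reflection_mx.
rewrite dotBl dotZl rowE mulmx1 -addrA -opprD -scalerDl.
set t := (X in X *: a); suff -> : t = 0 by rewrite scale0r subr0.
by rewrite /t; field.
Qed.

Lemma dot_reflection_mx (R : realType) (n : nat) (a v : 'rV[R]_n) :
  a != 0 -> dot (v *m reflection_mx a) (v *m reflection_mx a) = dot v v.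
Proof.
rewrite -dotvv_gt0 => /lt0r_neq0 a0.
rewrite mul_reflection_mx dotBl !dotBr !dotZl !dotZr (dotC a v).
by field.
Qed.

(** The matrix is an involution, so its determinant squares to 1; [absJac] does not see the sign. *)
Lemma normr_det_reflection_mx (R : realType) (n : nat) (a : 'rV[R]_n) :
  a != 0 -> `|\det (reflection_mx a)| = 1.
Proof.
move=> /reflection_mxK /(congr1 determinant); rewrite det_mulmx det1 -expr2.
by move=> /eqP; rewrite sqr_norm_eq1 => /eqP.
Qed.

Lemma jacobian_is_diff (R : realType) (n : nat) (f : 'rV[R]_n -> 'rV[R]_n)
    (x : 'rV[R]_n) (A : 'M[R]_n) :
  is_diff x f (mulmx^~ A) -> jacobian f x = A.
Proof.
move=> [_ fA]; apply/row_matrixP => i; rewrite !rowE mul_rV_lin1.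
by rewrite [LHS](congr1 (@^~ (delta_mx 0 i)) fA).
Qed.

Lemma is_diff_mulmxr (R : realType) (m n : nat) (A : 'M[R]_(m, n))
    (x : 'rV[R]_m) : is_diff x (mulmx^~ A) (mulmx^~ A).
Proof.
have -> : mulmx^~ A = (fun v : 'rV[R]_m => \sum_i v 0 i *: row i A).
  by apply/funext => v; exact: mulmx_sum_row.
apply: is_diff_sum => i.
exact: (@is_diff_comp _ _ _ _ _ _ _ _ x (is_diff_coord x 0 i)
  (is_diff_scalel _ _)).
Qed.

(** * Invariance applied to constant data *)

(** For u = 1 the transformed function is |Jac|^((n-2)/(2n)). The two hypotheses on [absJac]
    prescribe |Jac| and its logarithmic derivative at [x] so that this power has value [s] and
    gradient [p] there. The differential is a positive multiple [k] of an isometry [A], so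
    normalizing the image of [nu] leaves [nu *m A]. *)
Lemma conformal_invariance_one (R : realType) (n : nat) (hn : (3 <= n)%N)
    (B : boundary_operator R n)
    (psi : one_point_compactification 'rV[R]_n ->
           one_point_compactification 'rV[R]_n)
    (x : 'rV[R]_n) (A : 'M[R]_n) (k s : R) (p nu : 'rV[R]_n) (H : 'M[R]_n) :
  conformally_invariant B -> mobius psi -> psi (Some x) <> None ->
  0 < k -> (forall v, dot (v *m A) (v *m A) = dot v v) ->
  is_diff x (finite_part psi) (mulmx^~ (k *: A)) ->
  0 < s ->
  absJac (finite_part psi) x = s `^ (2 * n%:R / (n%:R - 2)) ->
  is_diff x (absJac (finite_part psi))
    (fun v => absJac (finite_part psi) x *
                (2 * n%:R / (n%:R - 2) * (dot p v / s))) ->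
  unit_vector nu -> H^T = H ->
  B x s p nu H =
  B (finite_part psi x) 1 0 (nu *m A)
    (s `^ (- (2 / (n%:R - 2))) *:
       (H + (2 / (n%:R - 2) * (dot p nu / s))%:M)).
Proof.
move=> hB mpsi psix k0 Aiso; set f := finite_part psi => df s0 Jx dJ nu1 HT.
have n0 : n%:R != 0 :> R by rewrite pnatr_eq0 -lt0n (leq_trans _ hn).
have n2 : n%:R - 2 != 0 :> R.
  by rewrite subr_eq0 eqr_nat gtn_eqF.
have grad1 : gradient (cst (1 : R) : 'rV[R]_n -> R) = cst 0.
  by apply/funext => y; apply/rowP => i; rewrite !mxE derive_cst.
have C11 : C1 (cst (1 : R) : 'rV[R]_n -> R).
  split; first by move=> y; exact: differentiable_cst.
  by rewrite grad1; exact: cst_continuous.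
have := hB psi (cst 1) (cst nu) (cst H) mpsi (fun=> ltr01) C11 (fun=> nu1)
  (@cst_continuous _ _ _ ) (fun=> HT) (@cst_continuous _ _ _) x psix.
rewrite /= -/f grad1.
have J0 : 0 < absJac f x by rewrite Jx powR_gt0.
have us : absJac f x `^ ((n%:R - 2) / (2 * n%:R)) = s.
  rewrite Jx -powRrM -[RHS]powRr1 ?(ltW s0)//; congr (_ `^ _).
  by field; rewrite n0 n2.
have -> : u_transform f (cst 1) x = s by rewrite /u_transform us mulr1.
(* With J = |Jac| and a = (n-2)/(2n), the chain rule gives a J^(a-1) dJ. Here J^a = s and dJ/J =
   (p.v)/(a s), so the result is p.v. *)
have -> : gradient (u_transform f (cst 1)) x = p.
  have -> : u_transform f (cst 1) =
      (fun t => t `^ ((n%:R - 2) / (2 * n%:R))) \o absJac f.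
    by apply/funext => y; rewrite /u_transform mulr1.
  apply/rowP => i; rewrite mxE.
  have [gd gE] := is_diff_derive_comp dJ
    (is_derive1_powR ((n%:R - 2) / (2 * n%:R)) J0).
  rewrite deriveE// gE.
  rewrite dot_delta powRB ?us ?powRr1 ?(ltW J0)//; last by rewrite (gt_eqF J0) implybT.
  by field; rewrite n0 n2 (gt_eqF s0) (gt_eqF J0).
have -> : nu_transform f (cst nu) x = nu *m A.
  rewrite /nu_transform diff_val /= -scalemxAr scalerA.
  have -> : enorm (k *: (nu *m A)) = k.
    rewrite /enorm dotZl dotZr Aiso (unit_vectorP nu).1// mulr1 -expr2.
    by rewrite sqrtr_sqr gtr0_norm.
  by rewrite mulVf ?scale1r// gt_eqF.
(* Here |Jac|^(-1/n) = s^(-2/(n-2)), and dividing the logarithmic gradient of |Jac| by n turns the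
   constant 2n/(n-2) into 2/(n-2). *)
suff -> : H_transform f (cst nu) (cst H) x =
  s `^ (- (2 / (n%:R - 2))) *: (H + (2 / (n%:R - 2) * (dot p nu / s))%:M) by [].
rewrite /H_transform Jx -powRrM; congr (_ `^ _ *: (_ + _%:M)).
  by field; rewrite n0 n2.
have -> : gradient (absJac f) x =
    (absJac f x * (2 * n%:R / (n%:R - 2) / s)) *: p.
  apply/rowP => i; rewrite !mxE deriveE; last by case: dJ.
  by rewrite diff_val dot_delta -!mulrA [s^-1 * _]mulrC.
rewrite dotZl -Jx /=; field.
by rewrite n0 n2 (gt_eqF s0) (gt_eqF J0).
Qed.

(** * Reductions by hyperplane reflections and dilations *)

(** The map is an affine isometry with |Jac| = 1 everywhere, so the previous lemma applies with k =
    s = 1 and p = 0. *)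
Lemma hyperplane_reflection_invariance (R : realType) (n : nat)
    (hn : (3 <= n)%N) (B : boundary_operator R n) (a : 'rV[R]_n) (t : R)
    (x nu : 'rV[R]_n) (H : 'M[R]_n) :
  conformally_invariant B -> a != 0 -> unit_vector nu -> H^T = H ->
  B x 1 0 nu H =
  B (x - (2 * (dot x a - t) / dot a a) *: a) 1 0 (nu *m reflection_mx a) H.
Proof.
move=> hB a0 nu1 HT.
have d0 : dot a a != 0 by rewrite gt_eqF ?dotvv_gt0.
set f := finite_part (hyperplane_reflection a t).
have fE y : f y = y *m reflection_mx a + (2 * t / dot a a) *: a.
  rewrite /f /finite_part /= sqr_enorm mul_reflection_mx.
  have -> : 2 * (dot y a - t) / dot a a = 2 * dot y a / dot a a - 2 * t / dot a a.
    by field.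
  by rewrite scalerBl opprB addrA addrAC.
have df y : is_diff y f (mulmx^~ (1 *: reflection_mx a)).
  rewrite scale1r.
  have -> : f = mulmx^~ (reflection_mx a) + cst ((2 * t / dot a a) *: a).
    by apply/funext => z; rewrite fE.
  by apply: is_diff_eq (is_diffD (is_diff_mulmxr _ y) (is_diff_cst _ y)) _; exact: addr0.
have J1 : absJac f = cst 1.
  apply/funext => y.
  by rewrite /absJac (jacobian_is_diff (df y)) scale1r normr_det_reflection_mx.
have dJ : is_diff x (absJac f) (fun v => absJac f x *
    (2 * n%:R / (n%:R - 2) * (dot 0 v / 1))).
  rewrite J1; apply: is_diff_eq (is_diff_cst _ x) _.
  by apply/funext => v; rewrite dot0l mul0r !mulr0.
rewrite (@conformal_invariance_one _ _ hn B (hyperplane_reflection a t) x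
  (reflection_mx a) 1 1 0 nu H hB _ _ _ _ (df x) _ _ dJ)//.
- rewrite dot0l mul0r mulr0 powR1 scale1r -scalemx1 scale0r addr0.
  by rewrite /finite_part /= sqr_enorm.
- exact: mobius_hyperplane.
- by move=> v; exact: dot_reflection_mx.
- by rewrite -/f J1 powR1.
Qed.

(** The dilation of centre [c] and ratio [r ^+ 2], written as a product of inversions because
    reflections are the generators of [mobius]. *)
Definition dilation (R : realType) (n : nat) (c : 'rV[R]_n) (r : R) :=
  sphere_inversion c r \o sphere_inversion c 1.

Lemma finite_part_dilation (R : realType) (n : nat) (c : 'rV[R]_n) (r : R)
    (y : 'rV[R]_n) :
  finite_part (dilation c r) y = c + r ^+ 2 *: (y - c).
Proof.
(* The centre goes to infinity under the first inversion and is brought back by the second. *)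
rewrite /finite_part /dilation /=; have [->|yc] := eqVneq y c.
  by rewrite /= subrr scaler0 addr0.
have d0 : dot (y - c) (y - c) != 0 by rewrite gt_eqF// dotvv_gt0 subr_eq0.
(* The first inversion moves [y] along its ray from [c] by a nonzero factor, so the image is not
   [c]. *)
rewrite /= ifF; last first.
  apply/negbTE; rewrite -subr_eq0 addrAC subrr add0r scaler_eq0 subr_eq0.
  by rewrite (negbTE yc) orbF sqr_enorm expr1n mul1r invr_eq0.
rewrite /= !sqr_enorm addrAC subrr add0r dotZl dotZr scalerA.
by congr (_ + _ *: _); field.
Qed.

(** A dilation has constant |Jac|, hence realizes p = 0. Centring it at [x] keeps the point
    fixed. *)
Lemma dilation_invariance (R : realType) (n : nat)
    (hn : (3 <= n)%N) (B : boundary_operator R n)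
    (x nu : 'rV[R]_n) (s : R) (H : 'M[R]_n) :
  conformally_invariant B -> 0 < s -> unit_vector nu -> H^T = H ->
  B x s 0 nu H = B x 1 0 nu (s `^ (- (2 / (n%:R - 2))) *: H).
Proof.
move=> hB s0 nu1 HT.
have n2 : n%:R - 2 != 0 :> R by rewrite subr_eq0 eqr_nat gtn_eqF.
(* This ratio gives |Jac| = k^n = s^(2n/(n-2)); the radius below is its square root because
   [dilation] has ratio [r ^+ 2]. *)
set k := s `^ (2 / (n%:R - 2)).
have k0 : 0 < k by exact: powR_gt0.
set r := Num.sqrt k.
have fE y : finite_part (dilation x r) y = x + k *: (y - x).
  by rewrite finite_part_dilation sqr_sqrtr// ltW.
set f := finite_part (dilation x r) in fE.
have df y : is_diff y f (mulmx^~ (k *: 1%:M)).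
  have -> : f = mulmx^~ (k *: 1%:M) + cst (x - k *: x).
    apply/funext => z; rewrite fE fctE /= -scalemxAr mulmx1 scalerBr.
    by rewrite addrCA.
  apply: is_diff_eq (is_diffD (is_diff_mulmxr _ y) (is_diff_cst _ y)) _.
  exact: addr0.
have J1 : absJac f = cst (s `^ (2 * n%:R / (n%:R - 2))).
  apply/funext => y.
  rewrite /absJac (jacobian_is_diff (df y)) detZ det1 mulr1.
  rewrite ger0_norm ?exprn_ge0 ?(ltW k0)// -powR_mulrn ?(ltW k0)// -powRrM.
  by congr (_ `^ _); rewrite mulrAC.
have fx : f x = x by rewrite fE subrr scaler0 addr0.
have dJ : is_diff x (absJac f) (fun v => absJac f x *
    (2 * n%:R / (n%:R - 2) * (dot 0 v / s))).
  rewrite J1; apply: is_diff_eq (is_diff_cst _ x) _.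
  by apply/funext => v; rewrite dot0l mul0r !mulr0.
rewrite (@conformal_invariance_one _ _ hn B (dilation x r) x
  1%:M k s 0 nu H hB _ _ _ _ (df x) _ _ dJ)//.
- rewrite -/f fx mulmx1 dot0l mul0r mulr0 -[0%:M]scalemx1 scale0r addr0.
  by [].
- by apply: mobius_comp; apply: mobius_sphere; rewrite // sqrtr_gt0.
- by rewrite /dilation /= eqxx.
- by move=> v; rewrite mulmx1.
- by rewrite -/f J1.
Qed.

Lemma position_normal_invariance (R : realType) (n : nat)
    (hn : (3 <= n)%N) (B : boundary_operator R n)
    (x nu e : 'rV[R]_n) (H : 'M[R]_n) :
  conformally_invariant B -> unit_vector nu -> unit_vector e -> H^T = H ->
  B x 1 0 nu H = B 0 1 0 e H.
Proof.
move=> hB nu1 e1 HT.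
wlog -> : x nu nu1 / x = 0.
  move=> wlg; have [->|x0] := eqVneq x 0; first exact: wlg.
  (* Reflection in the perpendicular bisector of 0 and [x] sends [x] to 0. It also changes the
     normal, which is why [nu] is generalized with [x]. *)
  rewrite (hyperplane_reflection_invariance hn (dot x x / 2) x hB x0 nu1 HT).
  apply: wlg.
    by apply/unit_vectorP; rewrite dot_reflection_mx//; exact/unit_vectorP.
  rewrite -[X in X - _]scale1r -scalerBl.
  have : dot x x != 0 by rewrite gt_eqF ?dotvv_gt0.
  move=> d0; set t := (X in X *: x).
  by suff -> : t = 0; [rewrite scale0r|rewrite /t; field].
have [->//|nue] := eqVneq nu e.
have nue0 : nu - e != 0 by rewrite subr_eq0.
(* The reflection with normal [nu - e] through the origin fixes 0 and exchanges the unit vectors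
   [nu] and [e]. *)
rewrite (hyperplane_reflection_invariance hn 0 0 hB nue0 nu1 HT).
rewrite dot0l subr0 mulr0 mul0r scale0r subr0 mul_reflection_mx.
have : dot (nu - e) (nu - e) != 0 by rewrite gt_eqF ?dotvv_gt0.
move: nu1 e1 => /unit_vectorP nu1 /unit_vectorP e1.
rewrite !(dotBl, dotBr) nu1 e1 (dotC e) => d0.
set t := (X in X *: _); have -> : t = 1 by rewrite /t; field.
by rewrite scale1r subKr.
Qed.

(** * Inversions: differential, Jacobian and the reduction for nonzero gradient *)

Section Inversion.
Variables (R : realType) (n : nat) (c : 'rV[R]_n) (r : R).
Let K (y : 'rV[R]_n) := r ^+ 2 / dot (y - c) (y - c).
Let f := finite_part (sphere_inversion c r).

Let near_neq y : y != c -> \forall z \near y, z != c.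
Proof.
move=> yc; apply: (@open_nbhs_nbhs _ y [set z | z != c]%classic); split=> //.
have -> : [set z | z != c]%classic = (~` [set c])%classic.
  by apply/seteqP; split=> z /eqP.
by apply: closed_openC; exact/accessible_closed_set1/hausdorff_accessible/norm_hausdorff.
Qed.

Let dot_neq0 y : y != c -> dot (y - c) (y - c) != 0.
Proof. by move=> yc; rewrite gt_eqF// dotvv_gt0 subr_eq0. Qed.

(** In the product rule for K(z)(z - c), the derivative of K contributes -2K ((y-c).v)/|y-c|^2
    (y-c), which completes K v to K times the reflection of v. *)
Lemma is_diff_sphere_inversion (y : 'rV[R]_n) :
  y != c -> is_diff y f (mulmx^~ (K y *: reflection_mx (y - c))).
Proof.
move=> yc; have d0 := dot_neq0 yc.
apply: (@near_eq_is_diff _ _ _ (fun z => c + K z *: (z - c))).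
  apply: filterS (near_neq yc) => z zc.
  by rewrite /f /finite_part /= (negbTE zc) /= sqr_enorm.
have dK : is_diff y K
    (fun v => - (r ^+ 2 / dot (y - c) (y - c) ^+ 2) * (2 * dot (y - c) v)).
  apply: (@is_diff_derive_comp _ _ _ _ (fun t => r ^+ 2 / t)).
    exact: is_diff_dotvv.
  have dV : is_derive (dot (y - c) (y - c)) (1 : R) (fun t : R => t^-1)
      (- (dot (y - c) (y - c)) ^- 2 *: 1).
    exact: is_deriveV.
  have := is_deriveZ (r ^+ 2) dV; rewrite /GRing.scale /= mulr1 mulrN.
  exact.
have dB : is_diff y (fun z => z - c) id.
  apply: is_diff_eq (is_diffB (is_diff_id y) (is_diff_cst c y)) _.
  by apply/funext => v; exact: subr0.
apply: is_diff_eq (is_diffD (is_diff_cst c y) (is_diff_scale dK dB)) _.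
apply/funext => v; rewrite fctE /= add0r -scalemxAr mul_reflection_mx [RHS]scalerBr.
rewrite scalerA -scaleNr /K (dotC v); congr (_ + _ *: _).
by field.
Qed.

Lemma absJac_sphere_inversion (y : 'rV[R]_n) : y != c -> absJac f y = K y ^+ n.
Proof.
move=> yc; have := is_diff_sphere_inversion yc => /jacobian_is_diff fE.
rewrite /absJac fE detZ normrM normr_det_reflection_mx ?subr_eq0// mulr1.
by rewrite ger0_norm// exprn_ge0// divr_ge0 ?sqr_ge0 ?dotvv_ge0.
Qed.

(** Near [y] the function is K^n with K = r^2/|y-c|^2, and the logarithmic derivative of |y-c|^(-2n)
    is -2n ((y-c).v)/|y-c|^2. *)
Lemma is_diff_absJac_sphere_inversion (y : 'rV[R]_n) : y != c ->
  is_diff y (absJac f) (fun v => absJac f y *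
    (- (2 * n%:R) * (dot (y - c) v / dot (y - c) (y - c)))).
Proof.
move=> yc; have d0 := dot_neq0 yc.
apply: (@near_eq_is_diff _ _ _ (fun z => K z ^+ n)).
  by apply: filterS (near_neq yc) => z zc; rewrite absJac_sphere_inversion.
have dV : is_derive (dot (y - c) (y - c)) (1 : R) (fun t : R => t^-1)
    (- (dot (y - c) (y - c)) ^- 2 *: 1).
  exact: is_deriveV.
have dK : is_diff y (fun z => K z ^+ n)
    (fun v => n%:R * K y ^+ n.-1 * (r ^+ 2 * - dot (y - c) (y - c) ^- 2) *
              (2 * dot (y - c) v)).
  apply: (@is_diff_derive_comp _ _ _ _ (fun t => (r ^+ 2 / t) ^+ n)).
    exact: is_diff_dotvv.
  have := is_deriveX n (is_deriveZ (r ^+ 2) dV).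
  rewrite exprfctE /GRing.scale /= mulr1; exact.
apply: is_diff_eq dK _; apply/funext => v; rewrite absJac_sphere_inversion//.
(* For m = 0 the truncated [m.-1] spoils a^(m-1) a = a^m, but the factor m then vanishes. *)
have nK m (a : R) : m%:R * a ^+ m.-1 * a = m%:R * a ^+ m.
  by case: m => [|m]; rewrite ?mul0r// exprSr mulrA.
transitivity (n%:R * K y ^+ n.-1 * K y *
    - (2 * dot (y - c) v / dot (y - c) (y - c))).
  by rewrite [in RHS]/K; set u := _ ^+ n.-1; field.
by rewrite nK; ring.
Qed.

End Inversion.

(** One inversion realizes both [s] and [p]: its centre adjusts the logarithmic gradient of |Jac|
    and its radius the value. The image point and normal stay unspecified, since
    [position_normal_invariance] normalizes them afterwards. *)
Lemma inversion_invariance (R : realType) (n : nat)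
    (hn : (3 <= n)%N) (B : boundary_operator R n)
    (x p nu : 'rV[R]_n) (s : R) (H : 'M[R]_n) :
  conformally_invariant B -> 0 < s -> p != 0 -> unit_vector nu -> H^T = H ->
  exists y nu', unit_vector nu' /\
    B x s p nu H = B y 1 0 nu' (s `^ (- (2 / (n%:R - 2))) *:
                       (H + (2 / (n%:R - 2) * (dot p nu / s))%:M)).
Proof.
move=> hB s0 p0 nu1 HT.
have n2 : 0 < n%:R - 2 :> R by rewrite subr_gt0 ltr_nat.
have pp0 : 0 < dot p p by rewrite dotvv_gt0.
(* With x - c = b p, the logarithmic derivative of |Jac| is -2n (p.v)/(b |p|^2); equating it with
   2n/(n-2) (p.v)/s determines b. *)
pose b := - ((n%:R - 2) * s / dot p p); pose c := x - b *: p.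
have b0 : b != 0 by rewrite oppr_eq0 gt_eqF// divr_gt0// mulr_gt0.
have xcE : x - c = b *: p by rewrite opprB addrC subrK.
have xc : x != c by rewrite -subr_eq0 xcE scaler_eq0 (negbTE b0).
pose k := s `^ (2 / (n%:R - 2)); have k0 : 0 < k by exact: powR_gt0.
have d0 : 0 < dot (x - c) (x - c) by rewrite dotvv_gt0 subr_eq0.
(* This radius makes the conformal factor at [x] equal to [k], hence |Jac| = k^n = s^(2n/(n-2))
   there. *)
pose r := Num.sqrt (k * dot (x - c) (x - c)).
have r0 : 0 < r by rewrite sqrtr_gt0 mulr_gt0.
have KE : r ^+ 2 / dot (x - c) (x - c) = k.
  by rewrite sqr_sqrtr ?mulfK ?gt_eqF// ltW// mulr_gt0.
have df := is_diff_sphere_inversion r xc.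
rewrite KE in df.
have dJ : is_diff x (absJac (finite_part (sphere_inversion c r)))
    (fun v => absJac (finite_part (sphere_inversion c r)) x *
                (2 * n%:R / (n%:R - 2) * (dot p v / s))).
  apply: is_diff_eq (is_diff_absJac_sphere_inversion r xc) _.
  apply/funext => v; rewrite xcE !dotZl dotZr /b; congr (_ * _); field.
  by rewrite !gt_eqF.
(* The equation is proved first, so that unification supplies the image point and normal. *)
eexists _, _; split; last first.
  apply: (@conformal_invariance_one _ _ hn B (sphere_inversion c r) x
    (reflection_mx (x - c)) k s p nu H hB _ _ k0 _ df s0 _ dJ nu1 HT).
  - exact: mobius_sphere.
  - by rewrite /= (negbTE xc).
  - by move=> v; rewrite dot_reflection_mx// subr_eq0.
  - rewrite absJac_sphere_inversion// KE -powR_mulrn ?(ltW k0)// -powRrM.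
    by congr (_ `^ _); rewrite mulrAC.
apply/unit_vectorP; rewrite dot_reflection_mx ?subr_eq0//.
exact/unit_vectorP.
Qed.

Theorem theorem6 (R : realType) (n : nat) (hn : (3 <= n)%N)
    (B : boundary_operator R n) (hB : conformally_invariant B) :
  (forall (x : 'rV[R]_n) (s : R) (p nu : 'rV[R]_n) (H : 'M[R]_n)
          (e : 'rV[R]_n),
      0 < s -> unit_vector nu -> H^T = H -> unit_vector e ->
      B x s p nu H =
      B 0 1 0 e (s `^ (- (2 / (n%:R - 2))) *:
                   (H + (2 / (n%:R - 2) * (dot p nu / s))%:M))) /\
  (exists g : R -> R,
    forall (x : 'rV[R]_n) (s : R) (p nu : 'rV[R]_n) (h : R),
      0 < s -> unit_vector nu ->
      B x s p nu (h%:M) =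
      g (s `^ (- (2 / (n%:R - 2))) *
           (h + 2 / (n%:R - 2) * (dot p nu / s)))).
Proof.
have normal_form x s p nu H e : 0 < s -> unit_vector nu -> H^T = H ->
    unit_vector e ->
    B x s p nu H = B 0 1 0 e (s `^ (- (2 / (n%:R - 2))) *:
                   (H + (2 / (n%:R - 2) * (dot p nu / s))%:M)).
  move=> s0 nu1 HT e1.
  have H'T t (a : R) : (t *: (H + a%:M))^T = t *: (H + a%:M).
    by rewrite linearZ linearD /= HT tr_scalar_mx.
  have [->|p0] := eqVneq p 0.
    have := H'T (s `^ (- (2 / (n%:R - 2)))) 0.
    rewrite dot0l mul0r mulr0 -[0%:M]scalemx1 scale0r addr0 => HsT.
    by rewrite dilation_invariance//; exact: position_normal_invariance.
  have [y [nu' [nu'1 ->]]] := inversion_invariance hn x hB s0 p0 nu1 HT.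
  exact: position_normal_invariance.
split; first exact: normal_form.
pose e : 'rV[R]_n := delta_mx 0 (Ordinal (leq_trans (isT : 0 < 3)%N hn)).
have e1 : unit_vector e.
  by apply/unit_vectorP; rewrite dot_delta mxE !eqxx.
(* For H = hI the matrix in the normal form is scalar, so the value depends on its single entry
   only. *)
exists (fun t => B 0 1 0 e t%:M) => x s p nu h s0 nu1.
rewrite (normal_form x s p nu h%:M e s0 nu1 (tr_scalar_mx _ _) e1).
by rewrite -raddfD /= scale_scalar_mx.
Qed.
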